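(* Given any separable, non-compact, metrizable space $X$, $$\mathfrak{d}\leq\chi_F(X)\leq\chi_R(X)\leq\mathrm{cof}(\mathcal{M}).$$
   Context: For a Tychonoff space $X$, $\beta X$ denotes its Čech–Stone compactification. A non-empty set $F\subset\beta X$ is a remote set (respectively, a far set) of $X$ if $F\cap\mathrm{cl}_{\beta X}(N)=\emptyset$ for every nowhere dense (respectively, closed discrete) subset $N$ of $X$. For a closed set $F\subset\beta X$, the character $\chi(F)$ of $F$ is the minimal cardinality of a family $\mathcal{U}$ of open subsets of $\beta X$ containing $F$ such that every open set containing $F$ contains a member of $\mathcal{U}$. For a non-compact Tychonoff space $X$, $\chi_R(X)$ is the minimal cardinal $\kappa$ such that there is a closed subset $F$ of $\beta X$ that is a remote set of $X$ and has $\chi(F)=\kappa$ ($\chi_R(X)=\infty$ if no remote sets exist), and $\chi_F(X)$ is the minimal cardinal $\kappa$ such that there is a closed subset $F$ of $\beta X$ that is a far set of $X$ and has $\chi(F)=\kappa$ ($\chi_F(X)=\infty$ if no far sets exist). $\mathfrak{d}$ is the dominating number: the least size of a family $\mathcal{G}\subset{}^\omega\omega$ such that for every $f\in{}^\omega\omega$ there is $g\in\mathcal{G}$ with $\{n<\omega:g(n)<f(n)\}$ finite. $\mathrm{cof}(\mathcal{M})$ is the cofinality of the ideal of meager subsets of the real line.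
   Formalization: The middle inequality χ_F(X) ≤ χ_R(X) is asserted only for X without isolated points: if p is isolated, {p} is a clopen remote set of character 1, so χ_R(X)=1<𝔡≤χ_F(X). The other two inequalities are stated for all X. *)

(* Defs.v *)
From HB Require Import structures.
From mathcomp Require Import all_boot all_order all_algebra.
From mathcomp Require Import all_classical all_reals all_analysis.
From mathcomp Require Import lra.

Set Implicit Arguments.
Unset Strict Implicit.
Unset Printing Implicit Defensive.

Import Order.TTheory GRing.Theory Num.Theory.
Import numFieldNormedType.Exports.

Local Open Scope classical_set_scope.
Local Open Scope card_scope.
Local Open Scope ring_scope.

(** Cardinals. A cardinal is represented by any type of that cardinality, and
    [Some K : xcard] stands for the cardinality of [K]; [None] is the symbol
    ∞, larger than every cardinal. [xcard_le] is invariant under equipotence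
    of the representatives. *)
Definition xcard := option Type.

Definition xcard_le (k l : xcard) : Prop :=
  match k, l with
  | _, None => True
  | None, Some _ => False
  | Some K, Some L => [set: K] #<= [set: L]
  end.

Declare Scope xcard_scope.
Delimit Scope xcard_scope with xcard.
Notation "k <= l" := (xcard_le k l) : xcard_scope.

(** [i] indexes a least member of the family [c i], [i] in [P]. *)
Definition argmin_card (I : Type) (P : set I) (c : I -> xcard) (i : I) : Prop :=
  P i /\ forall j, P j -> (c i <= c j)%xcard.

(** The least of the [c i] for [i] in [P]; it is ∞ when [P] is empty, and is
    attained otherwise ([min_cardP]). *)
Definition min_card (I : Type) (P : set I) (c : I -> xcard) : xcard :=
  match pselect (exists i, argmin_card P c i) with
  | left exi => c (sval (cid exi))
  | right _ => None
  end.

(** The least size of a set with property [P]. *)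
Definition min_size (T : Type) (P : set (set T)) : xcard :=
  min_card P (fun A => Some (set_type A)).

(** Cardinals are well-ordered: by Zorn's lemma there is a maximal set [S] of
    points of the product of the family on which all projections are injective,
    and some projection must map [S] onto its factor. *)
Lemma ex_argmin_type (I : Type) (K : I -> Type) : I ->
  exists i, forall j, [set: K i] #<= [set: K j].
Proof.
move=> i0; apply: contrapT => nomin.
pose T := forall i, K i.
pose good (S : set T) := forall i s t, S s -> S t -> s i = t i -> s = t.
have [F Fgood Ftot|S [gS maxS]] := @Zorn_bigcup T good.
  move=> i s t [A FA As] [B FB Bt].
  by have [AB|BA] := Ftot _ _ FA FB; [apply: (Fgood _ FB) (AB _ As) Bt|
                                      apply: (Fgood _ FA) As (BA _ Bt)].
have [[i surj]|nsurj] :=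
    pselect (exists i, forall y : K i, exists2 s, S s & s i = y).
  apply: nomin; exists i => j.
  have {}surj y : {s | S s /\ s i = y}.
    by apply: cid; have [s Ss sy] := surj y; exists s.
  pose f (y : K i) : K j := sval (surj y) j.
  have finj : {in [set: K i] &, injective f}.
    move=> y z _ _ fyz.
    have [Sy yE] := svalP (surj y); have [Sz zE] := svalP (surj z).
    by rewrite -yE -zE (gS j _ _ Sy Sz fyz).
  by rewrite -(card_le_eql (inj_card_eq finj)) card_leT.
have new i : {y : K i | forall s, S s -> s i <> y}.
  apply: cid; apply: contrapT => /forallNP h; apply: nsurj; exists i => y.
  by apply: contrapT => h'; apply: (h y) => s Ss sy; apply: h'; exists s.
pose t0 : T := fun i => sval (new i).
apply: (maxS (S `|` [set t0])).
  split=> [|h]; first by move=> s Ss; left.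
  have St0 : S t0 by apply: h; right.
  exact: (svalP (new i0) t0).
move=> i s t [Ss|->] [St|->] //; first exact: gS.
  by move=> e; have := svalP (new i) _ Ss e.
by move=> e; have := svalP (new i) _ St (esym e).
Qed.

Lemma min_card0 (I : Type) (c : I -> xcard) : min_card set0 c = None.
Proof. by rewrite /min_card; case: pselect => // -[i []]. Qed.

Lemma min_cardP (I : Type) (P : set I) (c : I -> xcard) : P !=set0 ->
  exists2 i, min_card P c = c i & argmin_card P c i.
Proof.
move=> [i0 Pi0].
suff exi : exists i, argmin_card P c i.
  rewrite /min_card; case: pselect => // exi'.
  by exists (sval (cid exi')) => //; exact: svalP.
have [[i1 Pi1 ci1]|inf] := pselect (exists2 i, P i & c i <> None); last first.
  exists i0; split=> // j Pj; have : c j = None.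
    by apply: contrapT => cj; apply: inf; exists j.
  by move=> ->; case: (c i0).
pose J := {i | P i /\ c i <> None}.
have [|j jmin] := @ex_argmin_type J (fun j => @odflt Type unit (c (sval j))).
  by exists i1.
exists (sval j); split=> [|k Pk]; first by case: (svalP j).
case ck : (c k) => [L|]; last by case: (c (sval j)).
have Jk : P k /\ c k <> None by rewrite ck.
have := jmin (exist _ k Jk); rewrite /= ck /=.
by case: (svalP j) => _; case: (c (sval j)).
Qed.

Definition metrizable (R : realType) (X : topologicalType) : Prop :=
  exists d : X -> X -> R,
    [/\ forall x y, d x y = 0 <-> x = y,
        forall x y, d x y = d y x,
        forall x y z, d x z <= d x y + d y z
      & forall x (A : set X), nbhs x A <->
          exists2 e : R, 0 < e & [set y | d x y < e] `<=` A].

Definition separable (X : topologicalType) : Prop :=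
  exists2 D : set X, countable D & dense D.

Definition crowded (X : topologicalType) : Prop := isolated [set: X] = set0.

Definition nowhere_dense (X : topologicalType) (N : set X) : Prop :=
  interior (closure N) = set0.

Definition meager (X : topologicalType) (M : set X) : Prop :=
  exists2 N : nat -> set X,
    forall n, nowhere_dense (N n) & M = \bigcup_n N n.

Definition closed_discrete (X : topologicalType) (D : set X) : Prop :=
  closed D /\ isolated D = D.

(** The Čech–Stone compactification of [X], as the closure of the image of [X]
    in the product of copies of [0, 1] indexed by the continuous functions
    X -> [0, 1]. The ambient product is R^(...), in which the cube is closed. *)
Section Cech_Stone.
Variables (R : realType) (X : topologicalType).

Definition unit_fun : set (X -> R) :=
  [set f : X -> R | continuous f /\ forall x, 0 <= f x <= 1].

Definition cs_eval : X -> prod_topology (fun _ : unit_fun => R) :=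
  join_product (fun f : unit_fun => val f).

Definition cs_compactification : set (prod_topology (fun _ : unit_fun => R)) :=
  closure (range cs_eval).

Definition beta : topologicalType := set_type cs_compactification.

Definition cs_in (x : X) : beta :=
  SigSub (mem_set (subset_closure (imageT cs_eval x))).

End Cech_Stone.

Arguments unit_fun : clear implicits.
Arguments cs_eval : clear implicits.
Arguments cs_compactification : clear implicits.
Arguments cs_in : clear implicits.

(** For metrizable [X], [cs_in] is a dense embedding of [X] in a compact
    Hausdorff space to which every continuous X -> [0, 1] extends, which
    characterizes the Čech–Stone compactification. *)
Section Cech_Stone_theory.
Variables (R : realType) (X : topologicalType).

Lemma cube_compact : compact [set f : prod_topology (fun _ : unit_fun R X => R) |
   forall i, `[0, 1]%classic (f i)].
Proof. by exact: (@tychonoff (unit_fun R X) (fun=> R) (fun=> `[0, 1]%classic) (fun=> @segment_compact R 0 1)). Qed.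

Lemma cs_compact : compact (cs_compactification R X).
Proof.
apply: (subclosed_compact _ cube_compact).
  exact: closed_closure.
have cl : closed [set f : prod_topology (fun _ : unit_fun R X => R) |
   forall i, `[0, 1]%classic (f i)].
  apply: compact_closed cube_compact.
  exact: (@hausdorff_product (unit_fun R X) (fun=> R) (fun=> @Rhausdorff R)).
move/closure_id : cl => ->; apply: closureS => _ [x _ <-] f /=.
by rewrite in_itv /=; have /set_mem [_ ] := valP f; exact.
Qed.

Lemma beta_compact : compact [set: beta R X].
Proof.
move=> F FF _.
have [] := @cs_compact (fmap (val : beta R X -> _) F) _.
  by apply: nearW => x /=; apply: set_mem; exact: valP.
move=> p [Cp clp]; exists (SigSub (mem_set Cp)); split=> // A B FA.
move=> [_ [[B' oB' <-] B'p BB]].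
have [||q [[y Ay <-] B'y]] := clp (val @` A) B'.
- by rewrite /fmap/=; apply: filterS FA => y Ay /=; exists y.
- by apply: open_nbhs_nbhs; split.
by exists y; split=> //; exact: BB.
Qed.

Lemma beta_hausdorff : hausdorff_space (beta R X).
Proof.
move=> p q pq; apply/val_inj.
have H : hausdorff_space (prod_topology (fun _ : unit_fun R X => R)).
  exact: (@hausdorff_product (unit_fun R X) (fun=> R) (fun=> @Rhausdorff R)).
apply: H => A B nA nB.
have cv : continuous (val : beta R X -> prod_topology (fun _ : unit_fun R X => R)).
  exact: initial_continuous.
have [z [? ?]] := pq _ _ (cv _ _ nA) (cv _ _ nB).
by exists (val z).
Qed.

Lemma beta_dense : dense (range (cs_in R X)).
Proof.
move=> O [p Op] [W oW OE]; have /set_mem Cp := valP p.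
have [|q [[x _ xq] xW]] := Cp W; last subst q.
  by apply: open_nbhs_nbhs; split=> //; rewrite -OE in Op.
by exists (cs_in R X x); split; [rewrite -OE|exists x].
Qed.

Lemma beta_extend (f : X -> R) : continuous f -> (forall x, 0 <= f x <= 1) ->
  exists2 g : beta R X -> R, continuous g & forall x, g (cs_in R X x) = f x.
Proof.
move=> cf f01; have uf : unit_fun R X f by [].
pose i : unit_fun R X := SigSub (mem_set uf).
exists (fun p => val p i) => // p.
apply: (@continuous_comp _ _ _ (val : beta R X -> prod_topology _) (fun q => q i)).
  exact: initial_continuous.
exact: (@proj_continuous _ (fun=> R) i).
Qed.

Lemma metrizable_sep : metrizable R X ->
  separate_points_from_closed (fun f : unit_fun R X => val f : X -> R).
Proof.
move=> [d [d0 ds dt dn]] U x cU Ux.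
have [e e0 eU] : exists2 e : R, 0 < e & [set y | d x y < e] `<=` ~` U.
  by apply/dn; apply: open_nbhs_nbhs; split => //; exact: closed_openC.
have dge y z : 0 <= d y z.
  have := dt y z y; rewrite (ds z y) (d0 y y).2//; lra.
pose f y := Num.min 1 (d x y / e).
have cd : continuous (d x : X -> R).
  move=> y; apply/cvgrPdist_lt => r r0; apply/dn; exists r => // z /= yz.
  rewrite ltr_norml; have := dt x y z; have := dt x z y; rewrite (ds z y); lra.
have uf : unit_fun R X f.
  split=> [|y].
    move=> y; apply: (@continuous_min _ _ (cst 1) (fun y => d x y / e)).
      exact: cvg_cst.
    apply: cvgM; [exact: cd|exact: cvg_cst].
  rewrite /f le_min ge_min lexx/= ler01/= divr_ge0//; exact: ltW.
exists (SigSub (mem_set uf)) => /= cl.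
have fU y : U y -> f y = 1.
  move=> Uy; apply/min_idPl; rewrite ler_pdivlMr// mul1r leNgt; apply/negP => /eU; exact.
have fx : f x = 0 by rewrite /f (d0 x x).2// mul0r; apply/min_idPr; rewrite ler01.
have [|z [[y Uy <-]]] := cl (ball (f x) 1); first exact: nbhsx_ballx.
by rewrite fx fU// /ball/= sub0r normrN normr1 ltxx.
Qed.

Lemma metrizable_embed : metrizable R X ->
  injective (cs_in R X) /\
  forall U : set X, open U <-> exists2 V, open V & cs_in R X @^-1` V = U.
Proof.
move=> mX; have sep := metrizable_sep mX.
have cts (f : unit_fun R X) : continuous (val f : X -> R) by case: (set_mem (valP f)).
have inj : set_inj [set: X] (cs_eval R X).
  apply: (join_product_inj sep) => y x /eqP yx.
  exists (~` [set x]); rewrite !inE /=; split=> //; try by move=> h; apply: h.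
  have [d [d0 ds dt dn]] := mX.
  rewrite openE => {yx}y yx; apply/dn; exists (d y x).
    have dn0 : d y x <> 0 by move/d0.
    have := dt y x y; rewrite (ds x y) (d0 y y).2//; move/eqP: dn0.
    rewrite lt_neqAle eq_sym => -> /=; lra.
  by move=> z /= yz zx; move: yz; rewrite zx ltxx.
split.
  by move=> x y /(congr1 val)/inj; apply; rewrite inE.
move=> U; have -> := join_product_initial sep cts inj; split.
  move=> [V oV <-]; exists (val @^-1` V) => //; by exists V.
by move=> [_ [V oV <-] <-]; exists V.
Qed.
End Cech_Stone_theory.

(** The character of [F] in [B]: the least size of a base of open
    neighborhoods of [F]. *)
Definition nbhd_base (B : topologicalType) (F : set B) (U : set (set B)) :=
  (forall V, U V -> open V /\ F `<=` V) /\
  (forall W, open W -> F `<=` W -> exists2 V, U V & V `<=` W).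

Definition character (B : topologicalType) (F : set B) : xcard :=
  min_size (nbhd_base F).

Section invariants.
Variables (R : realType) (X : topologicalType).
Implicit Types F : set (beta R X).

Definition remote_set F : Prop :=
  F !=set0 /\ forall N : set X, nowhere_dense N ->
    F `&` closure (cs_in R X @` N) = set0.

Definition far_set F : Prop :=
  F !=set0 /\ forall D : set X, closed_discrete D ->
    F `&` closure (cs_in R X @` D) = set0.

Definition chi_R : xcard :=
  min_card [set F | closed F /\ remote_set F] (@character (beta R X)).

Definition chi_F : xcard :=
  min_card [set F | closed F /\ far_set F] (@character (beta R X)).

End invariants.

Definition dominating (G : set (nat -> nat)) : Prop :=
  forall f : nat -> nat,
    exists2 g, G g & finite_set [set n | (g n < f n)%N].

Definition dominating_number : xcard := min_size dominating.

Definition cofinal_meager (R : realType) (C : set (set R)) : Prop :=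
  (forall M, C M -> meager M) /\
  (forall A : set R, meager A -> exists2 M, C M & A `<=` M).

Definition cof_meager (R : realType) : xcard := min_size (@cofinal_meager R).

(* Main.v *)
Require Import Defs.
From HB Require Import structures.
From mathcomp Require Import all_boot all_order all_algebra.
From mathcomp Require Import all_classical all_reals all_analysis.
From mathcomp Require Import zify lra.
Import Order.TTheory GRing.Theory Num.Theory.
Import numFieldNormedType.Exports.
Local Open Scope classical_set_scope.

(* Let B_0, B_1, ... be a countable base of X.

   Lower bound: Lindelöf splits X into layers S_n such that no finite union of
   layers is adherent to the far set F. With (pt n i) dense in S_n, every D_f =
   {pt n i | i <= f n} is closed discrete, so some basic neighborhood V of F
   misses it; recording, for each m, the index of some point of V in a layer
   n >= m gives a function attached to V alone that dominates each monotone f.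

   Upper bound: van Douwen's n-linked families, one for each member U_n of a
   locally finite sequence of open sets, assign to each way of shrinking the
   B_i away from a nowhere dense set an open set A in such a way that these A
   have the finite intersection property; the intersection F of their closures
   in beta X is remote, and the finite intersections of the largest open sets of
   beta X with trace A form a base at F. It remains to avoid all nowhere dense
   sets of X by cof(M) many ways of shrinking. A dense open D of the poset of
   the B_i is turned into a meager set of reals, coding the walks in the poset
   that avoid D, each of whose portions contains a copy of all such walks; if it
   is covered by nowhere dense sets N_i, then by a Baire argument one of the N_i
   already determines, near some point, a dense set contained in D. *)

Set Implicit Arguments.
Unset Strict Implicit.
Unset Printing Implicit Defensive.

(** * Infinite cardinals *)

Lemma card_le_injP (T U : Type) :
  ([set: T] #<= [set: U])%card <-> exists f : T -> U, injective f.
Proof.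
split=> [/card_leP[f]|[f finj]].
  exists (fun x => val (f (SigSub (mem_set (I : [set: T] x))))) => x y /val_inj fxy.
  have : SigSub (mem_set (I : [set: T] x)) = SigSub (mem_set (I : [set: T] y)).
    by apply: (@inj _ _ _ f) => //; rewrite inE.
  by move/(congr1 val).
have fi : {in [set: T] &, injective f} by move=> x y _ _; exact: finj.
by rewrite -(card_le_eql (inj_card_eq fi)) card_leT.
Qed.

Lemma injective_total (T U : Type) :
  (exists f : T -> U, injective f) \/ (exists f : U -> T, injective f).
Proof.
have [b bmin] := @ex_argmin_type bool (fun b => if b then T else U) true.
by case: b bmin => bmin; [left; have := bmin false|right; have := bmin true];
  move/card_le_injP.
Qed.

Section hessenberg.
Variable K : Type.
Implicit Types G : set (K * K * K).

(** The domain is read off the diagonal, so that a pairing is a bare set of triples, ordered by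
    inclusion as Zorn's lemma requires. *)
Let dom G : set K := [set x | exists y, G (x, x, y)].

Let pairing G : Prop :=
  [/\ forall a y y', G (a, y) -> G (a, y') -> y = y',
      forall a a' y, G (a, y) -> G (a', y) -> a = a',
      forall a b, dom G a -> dom G b -> exists y, G (a, b, y)
    & forall a b y, G (a, b, y) -> [/\ dom G a, dom G b & dom G y]].

Let pairing_bigcup (F : set (set (K * K * K))) :
  F `<=` pairing -> total_on F subset -> pairing (\bigcup_(G in F) G).
Proof.
move=> Fp Ft.
have two s t : (\bigcup_(G in F) G) s -> (\bigcup_(G in F) G) t ->
    exists2 G, F G & G s /\ G t.
  move=> [G FG Gs] [H FH Ht]; have [GH|HG] := Ft _ _ FG FH.
    by exists H => //; split=> //; exact: GH.
  by exists G => //; split=> //; exact: HG.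
have up G x : F G -> dom G x -> dom (\bigcup_(G in F) G) x.
  by move=> FG [y Gy]; exists y; exists G.
split.
- move=> a y y' h h'; have [G FG [Gy Gy']] := two _ _ h h'.
  by have [f _ _ _] := Fp _ FG; exact: f Gy Gy'.
- move=> a a' y h h'; have [G FG [Gy Gy']] := two _ _ h h'.
  by have [_ f _ _] := Fp _ FG; exact: f Gy Gy'.
- move=> a b [y h] [y' h']; have [G FG [Gy Gy']] := two _ _ h h'.
  have [_ _ f _] := Fp _ FG.
  by have [||z Gz] := f a b; [exists y|exists y'|exists z; exists G].
move=> a b y [G FG Gy]; have [_ _ _ f] := Fp _ FG.
by have [? ? ?] := f _ _ _ Gy; split; exact: up FG _.
Qed.

(* A maximal pairing on a set [B] extends to [B] together with a copy [ee @` B]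
   outside [B], the new pairs being coded by copies of triples (tag, q x, q y);
   hence [B] does not embed in its complement, and [K] embeds in [B]. *)
Lemma hessenberg : infinite_set [set: K] -> exists p : K * K -> K, injective p.
Proof.
move=> /infiniteP /card_le_injP [i0 i0inj].
pose c (n m : nat) := pickle (n, m).
have cinj n m n' m' : c n m = c n' m' -> n = n' /\ m = m'.
  by move/(pcan_inj pickleK) => [].
pose G0 : set (K * K * K) := [set t | exists n m,
   t = (i0 n, i0 m, i0 (c n m))].
have dG0 n : dom G0 (i0 n) by exists (i0 (c n n)), n, n.
have pG0 : pairing G0.
  split.
  - by move=> a y y' [n [m [-> ->]]] [n' [m' [/i0inj-> /i0inj-> ->]]].
  - move=> a a' y [n [m [-> ->]]] [n' [m' [-> /i0inj e]]].
    by have [-> ->] := cinj _ _ _ _ e.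
  - move=> a b [y [n [m [-> _ _]]]] [y' [n' [m' [-> _ _]]]].
    by exists (i0 (c n n')), n, n'.
  - by move=> a b y [n [m [-> -> ->]]].
(* Adjoining [G0] gives the maximal pairing an infinite domain. *)
have [F Fp Ft|A [pA maxA]] := @Zorn_bigcup _ (fun G => pairing (G `|` G0)).
  have [F0|/set0P[G1 FG1]] := eqVneq F set0.
    by rewrite F0 bigcup_set0 set0U.
  have -> : \bigcup_(X in F) X `|` G0 = \bigcup_(X in [set X `|` G0 | X in F]) X.
    apply/seteqP; split=> [t [[X FX Xt]|G0t]|t [_ [X FX <-] [Xt|G0t]]].
    - by exists (X `|` G0); [exists X|left].
    - by exists (G1 `|` G0); [exists G1|right].
    - by left; exists X.
    - by right.
  apply: pairing_bigcup; first by move=> _ [X FX <-]; exact: Fp.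
  move=> _ _ [X FX <-] [Y FY <-].
  by have [XY|YX] := Ft _ _ FX FY; [left|right]; apply: setSU.
pose G := A `|` G0; pose B := dom G.
have dB n : B (i0 n) by have [y Gy] := dG0 n; exists y; right.
have [fun_ inj_ tot_ dom_] := pA.
have ex_p (x : K * K) : exists y, (B x.1 /\ B x.2) -> G (x, y).
  have [[B1 B2]|nB] := pselect (B x.1 /\ B x.2); last by exists x.1.
  by have [y Gy] := tot_ _ _ B1 B2; exists y => _; case: x {B1 B2} Gy.
pose p x := sval (cid (ex_p x)).
have pE x : B x.1 -> B x.2 -> G (x, p x).
  by move=> B1 B2; apply: (svalP (cid (ex_p x))).
have pinj x y : B x.1 -> B x.2 -> B y.1 -> B y.2 -> p x = p y -> x = y.
  move=> B1 B2 B3 B4 e; have := pE _ B1 B2; rewrite e => h.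
  by apply: inj_ h (pE _ B3 B4).
have Bp x y : B x -> B y -> B (p (x, y)).
  by move=> Bx By; have [] := dom_ _ _ _ (@pE (x, y) Bx By).
have t01 : i0 0 <> i0 1 by move/i0inj.
have [[e einj]|[e einj]] := injective_total (set_type B) (set_type (~` B)).
  exfalso.
  (* [q] will be a retraction onto [B] that inverts [e] on its image, with default value [i0 0]
     elsewhere. *)
  have proj_ex x : exists b, B b /\
      ((B x -> b = x) /\ (forall c : set_type B, x = val (e c) -> b = val c)).
    have [Bx|nBx] := pselect (B x).
      exists x; split=> //; split=> // b xb.
      by have := set_mem (valP (e b)); rewrite -xb.
    have [[b xb]|nb] := pselect (exists b, x = val (e b)).
      exists (val b); split; first exact: set_mem (valP b).
      by split=> // b'; rewrite xb => /val_inj/einj ->.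
    exists (i0 0); split=> //; split=> // b xb.
    by exfalso; apply: nb; exists b.
  pose q x := sval (cid (proj_ex x)).
  have Bq x : B (q x) by have [] := svalP (cid (proj_ex x)).
  have qB x : B x -> q x = x by have [_ []] := svalP (cid (proj_ex x)).
  have qe b : q (val (e b)) = val b.
    by have [_ [_]] := svalP (cid (proj_ex (val (e b)))); apply.
  pose ee b := val (e (insubd (SigSub (mem_set (dB 0))) b)).
  have eeB b : B b -> ~ B (ee b).
    by move=> Bb; exact: set_mem (valP (e _)).
  have qee b : B b -> q (ee b) = b.
    by move=> Bb; rewrite qe insubdK// mem_set.
  pose D := B `|` ee @` B.
  have qinj x y : D x -> D y -> `[< B x >] = `[< B y >] -> q x = q y -> x = y.
    move=> [Bx|[b Bb <-]] [By|[b' Bb' <-]].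
    - by rewrite !qB.
    - by move=> h; have /asboolP := Bx; rewrite h => /asboolP /(eeB _ Bb').
    - by move=> h; have /asboolP := By; rewrite -h => /asboolP /(eeB _ Bb).
    - by move=> _; rewrite !qee// => ->.
  (* [q] is two-to-one on [D]; the tag records which coordinates lie in [B]. *)
  pose tag (x : K * K) :=
    i0 (c (nat_of_bool `[< B x.1 >]) (nat_of_bool `[< B x.2 >])).
  have tagP x y : tag x = tag y ->
      `[< B x.1 >] = `[< B y.1 >] /\ `[< B x.2 >] = `[< B y.2 >].
    by move=> /i0inj/cinj[]; do 4!case: asboolP.
  pose r x := ee (p (tag x, p (q x.1, q x.2))).
  have Br x : B (p (tag x, p (q x.1, q x.2))) by exact: (Bp _ _ (dB _) (Bp _ _ (Bq _) (Bq _))).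
  pose H : set (K * K * K) := [set t | D t.1.1 /\ D t.1.2 /\
    ~ (B t.1.1 /\ B t.1.2) /\ t.2 = r t.1].
  have GD a y : G (a, y) -> [/\ B a.1, B a.2 & B y].
    by case: a => a b; exact: dom_.
  have HG a y : H (a, y) -> ~ (B a.1 /\ B a.2) /\ ~ B y.
    by move=> [/= _ [_ [? ->]]]; split=> //; exact: eeB.
  have rinj a a' y : H (a, y) -> H (a', y) -> a = a'.
    move=> [/= D1 [D2 [_ ->]]] [/= D3 [D4 [_]]].
    move=> /(congr1 q); rewrite !qee// => /pinj.
    move=> /(_ (dB _) (Bp _ _ (Bq _) (Bq _)) (dB _) (Bp _ _ (Bq _) (Bq _))).
    move=> [/tagP[t1 t2] /pinj].
    move=> /(_ (Bq _) (Bq _) (Bq _) (Bq _)) [].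
    by case: a a' D1 D2 D3 D4 t1 t2 => [a b] [a' b'] /= *; congr pair; exact: qinj.
  have dGH x : dom (G `|` H) x -> D x.
    by case=> y [/dom_ [Bx _ _]|[]]; [left|].
  have DdGH x : D x -> dom (G `|` H) x.
    case=> [[y Gy]|[b Bb <-]]; first by exists y; left.
    exists (r (ee b, ee b)); right; split; first by right; exists b.
    split; first by right; exists b.
    by split=> //= -[h _]; exact: (eeB _ Bb h).
  have pGH : pairing (G `|` H).
    split.
    - move=> a y y' [h|h] [h'|h'].
      + exact: fun_ h h'.
      + by have [? ? _] := GD _ _ h; have [[]] := HG _ _ h'.
      + by have [? ? _] := GD _ _ h'; have [[]] := HG _ _ h.
      + by case: h h' => [_ [_ [_ /= ->]]] [_ [_ [_ /= ->]]].
    - move=> a a' y [h|h] [h'|h'].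
      + exact: inj_ h h'.
      + by have [_ _ ?] := GD _ _ h; have [_ []] := HG _ _ h'.
      + by have [_ _ ?] := GD _ _ h'; have [_ []] := HG _ _ h.
      + exact: rinj h h'.
    - move=> a b /dGH Da /dGH Db.
      have [[Ba Bb]|nB] := pselect (B a /\ B b).
        by have [y Gy] := tot_ _ _ Ba Bb; exists y; left.
      by exists (r (a, b)); right.
    - move=> a b y [/dom_[? ? ?]|[/= Da [Db [_ ->]]]].
        by split; apply: (DdGH); left.
      by split; apply: (DdGH) => //; right; eexists; last reflexivity.
  apply: (maxA (A `|` H)).
    split=> [|h]; first by move=> s As; left.
    have : A (ee (i0 0), ee (i0 0), r (ee (i0 0), ee (i0 0))).
      apply: h; right; split; first by right; exists (i0 0).
      split; first by right; exists (i0 0).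
      by split=> //= -[h' _]; exact: (eeB _ (dB 0) h').
    by move=> As; have [/= /(eeB _ (dB 0))] := GD _ _ (or_introl As : G _).
  by rewrite setUAC.
(* Both [B] and its complement embed in [B]; the tags [i0 0] and [i0 1] keep the images apart. The
   last branch never occurs. *)
pose g x : K := if pselect (B x) is left _ then p (i0 0, x) else
  if pselect ((~` B) x) is left nB then
    p (i0 1, val (e (SigSub (mem_set nB)))) else x.
have gB x : B (g x).
  rewrite /g; case: pselect => [Bx|nBx]; first exact: Bp.
  by case: pselect => // nB; apply: (Bp) => //; exact: set_mem (valP (e _)).
have pinj2 a b a' b' : B a -> B b -> B a' -> B b' ->
    p (a, b) = p (a', b') -> a = a' /\ b = b'.
  by move=> h1 h2 h3 h4 h; have [] := pinj (a, b) (a', b') h1 h2 h3 h4 h.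
have eB nB : B (val (e nB)) := set_mem (valP (e nB)).
have ginj : injective g.
  move=> x y; rewrite /g; case: pselect => Bx; case: pselect => By.
  - by move=> h; have [] := pinj2 _ _ _ _ (dB 0) Bx (dB 0) By h.
  - case: pselect => // nB h.
    by have [/t01] := pinj2 _ _ _ _ (dB 0) Bx (dB 1) (eB _) h.
  - case: pselect => [By'|nBy] h.
      by have [/esym/t01] := pinj2 _ _ _ _ (dB 1) (eB _) (dB 0) By' h.
    move: h; case: pselect => // nB h.
    have [_] := pinj2 _ _ _ _ (dB 1) (eB _) (dB 1) (eB _) h.
    by move=> /val_inj/einj/(congr1 val).
  - by [].
exists (fun x => p (g x.1, g x.2)) => -[a b] [a' b'] /= h.
by have [/ginj -> /ginj ->] := pinj2 _ _ _ _ (gB _) (gB _) (gB _) (gB _) h.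
Qed.

(** The length is recorded because the iterated pairing alone need not determine it. *)
Lemma card_seq_le : infinite_set [set: K] -> ([set: seq K] #<= [set: K])%card.
Proof.
move=> iK; have [p pinj] := hessenberg iK.
have /infiniteP /card_le_injP [i iinj] := iK.
apply/card_le_injP; exists (fun s => p (i (size s), foldr (fun x y => p (x, y)) (i 0) s)).
move=> s t /pinj [/iinj]; elim: s t => [|x s IH] [|y t] //= [st] /pinj[-> h].
by rewrite (IH t).
Qed.

Lemma card_prod_le (U : Type) : infinite_set [set: K] ->
  ([set: U] #<= [set: K])%card -> ([set: K * U] #<= [set: K])%card.
Proof.
move=> /hessenberg[p pinj] /card_le_injP[f finj]; apply/card_le_injP.
exists (fun x => p (x.1, f x.2)) => -[a b] [a' b'] /pinj[/= -> /finj ->] //.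
Qed.

End hessenberg.

(** * The binary tree of open intervals *)

Lemma nowhere_denseP (T : topologicalType) (N : set T) :
  nowhere_dense N <-> forall O, open O -> O !=set0 ->
    exists O', [/\ open O', O' !=set0, O' `<=` O & O' `&` N = set0].
Proof.
split=> [nN O oO [x Ox]|h].
  have [OcN|] := pselect (O `<=` closure N).
    have : (closure N)^° x by apply: (filterS OcN); exact: open_nbhs_nbhs.
    by rewrite nN.
  move=> /existsNP[y /not_implyP[Oy nNy]].
  exists (O `&` ~` closure N); split.
  - by apply: openI => //; apply: closed_openC; exact: closed_closure.
  - by exists y.
  - by move=> z [].
  - by apply/seteqP; split=> // z [[_ nz] /subset_closure].
apply/seteqP; split=> // x xN.
have [|O' [oO' [y O'y] sub O'N]] := h _ (open_interior (closure N)).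
  by exists x.
have [z [Nz O'z]] := interior_subset (sub _ O'y) O' (open_nbhs_nbhs (conj oO' O'y)).
by have : (O' `&` N) z by []; rewrite O'N.
Qed.

Section bisection.
Variable R : realType.
Local Open Scope ring_scope.
Implicit Types (s t u v w : seq bool) (ab : R * R) (r : R).

Definition bisect ab (b : bool) : R * R :=
  if b then ((ab.1 + ab.2) / 2, ab.2) else (ab.1, (ab.1 + ab.2) / 2).

Definition node s : R * R := foldl bisect (0, 1) s.

(** Open intervals lose dyadic rationals, but cells that meet come from comparable nodes. *)
Definition cell s : set R := [set r | (node s).1 < r < (node s).2].

Lemma node_cat s t : node (s ++ t) = foldl bisect (node s) t.
Proof. by rewrite /node foldl_cat. Qed.

Lemma node_rcons s b : node (rcons s b) = bisect (node s) b.
Proof. by rewrite -cats1 node_cat. Qed.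

Lemma node_length s : (node s).2 - (node s).1 = 2^-1 ^+ size s.
Proof.
elim/last_ind: s => [|s b IH]; first by rewrite /= subr0 expr0.
rewrite node_rcons size_rcons exprS -IH /bisect; case: b => /=; lra.
Qed.

Lemma node_lt s : (node s).1 < (node s).2.
Proof. by rewrite -subr_gt0 node_length exprn_gt0// invr_gt0. Qed.

Lemma node_le s t : (node s).1 <= (node (s ++ t)).1 /\ (node (s ++ t)).2 <= (node s).2.
Proof.
elim/last_ind: t => [|t b [IH1 IH2]]; first by rewrite cats0.
rewrite -rcons_cat node_rcons /bisect; have := node_lt (s ++ t).
by case: b => /=; lra.
Qed.

Lemma cell_cat s t : cell (s ++ t) `<=` cell s.
Proof. by move=> r; rewrite /cell /=; have := node_le s t; lra. Qed.

Lemma cell_neq0 s : cell s !=set0.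
Proof.
exists (((node s).1 + (node s).2) / 2); rewrite /cell/=; have := node_lt s; lra.
Qed.

Lemma open_cell s : open (cell s).
Proof.
have -> : cell s = `](node s).1, (node s).2[%classic.
  by apply/seteqP; split=> r; rewrite /cell /= in_itv.
exact: itv_open.
Qed.

Lemma cell_prefix s t r : (size s <= size t)%N -> cell s r -> cell t r ->
  exists u, t = s ++ u.
Proof.
elim/last_ind: s t => [|s b IH] t; first by exists t.
rewrite size_rcons => st; rewrite -cats1 => sr tr.
have [[|b' u] tE] := IH t (ltnW st) (cell_cat sr) tr.
  by move: st; rewrite tE cats0 ltnn.
exists u; rewrite -catA tE; congr (_ ++ _) => /=; congr (_ :: _).
move: tr; rewrite tE -cat1s catA => /cell_cat.
move: sr; rewrite /cell/= !cats1 !node_rcons /bisect.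
by case: b b' {tE} => -[] //=; lra.
Qed.

(** The right turn moves off the left endpoint of [cell s], the later left turn off the right
    one. *)
Lemma closed_cell_sub s w r :
  (node (s ++ true :: rcons w false)).1 <= r <= (node (s ++ true :: rcons w false)).2 ->
  cell s r.
Proof.
rewrite -rcons_cons -rcons_cat node_rcons /bisect/=.
have -> : s ++ true :: w = rcons s true ++ w by rewrite cat_rcons.
have := node_le (rcons s true) w; have := node_lt (rcons s true ++ w).
rewrite node_rcons /cell/= /bisect /=; have := node_lt s.
lra.
Qed.

Lemma cell_pi_base (O : set R) s : open O -> O `&` cell s !=set0 ->
  exists v, cell (s ++ v) `<=` O.
Proof.
move=> oO [y [Oy sy]].
have [e /= e0 eO] := open_nbhs_nbhs (conj oO Oy).
have tow n : exists v, size v = n /\ (node (s ++ v)).1 <= y <= (node (s ++ v)).2.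
  elim: n => [|n [v [sv yv]]].
    by exists [::]; rewrite cats0; split=> //; move: sy; rewrite /cell/=; lra.
  have [h|h] := leP y (((node (s ++ v)).1 + (node (s ++ v)).2) / 2).
    exists (rcons v false); rewrite size_rcons sv -rcons_cat node_rcons; split=> //=.
    by move: h yv; lra.
  exists (rcons v true); rewrite size_rcons sv -rcons_cat node_rcons; split=> //=.
  by move: h yv; lra.
have [n ne] : exists n, (2^-1 : R) ^+ n < e.
  have := @cvg_geometric R 1 2^-1 _.
  rewrite ger0_norm ?invr_ge0// invf_lt1// ltr1n => /(_ isT) /cvgrPdist_lt.
  move=> /(_ _ e0) [n _ /(_ n (leqnn n))] /=.
  rewrite /geometric/= mul1r sub0r normrN ger0_norm; last by rewrite exprn_ge0// invr_ge0.
  by exists n.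
have [v [sv yv]] := tow n; exists v => r; rewrite /cell/= => rv; apply: eO => /=.
have := node_length (s ++ v); rewrite size_cat sv exprD.
have : (2^-1 : R) ^+ size s <= 1 by rewrite exprn_ile1 ?invr_ge0 ?invf_le1// ler1n.
have : 0 < (2^-1 : R) ^+ n by rewrite exprn_gt0// invr_gt0.
move=> h1 h2 h3; have {h2}: (2^-1 : R) ^+ size s * 2^-1 ^+ n <= 2^-1 ^+ n.
  by rewrite ger_pMl.
move=> h2; rewrite ltr_norml; move: rv yv; lra.
Qed.

Lemma nowhere_dense_cell (N : set R) s : nowhere_dense N ->
  exists v, cell (s ++ v) `&` N = set0.
Proof.
move=> /nowhere_denseP /(_ _ (@open_cell s) (@cell_neq0 s)) [V [oV [y Vy] Vs VN]].
have [|v vO] := @cell_pi_base V s oV; first by exists y; split=> //; exact: Vs.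
by exists v; apply/seteqP; split=> // r [/vO Vr Nr]; rewrite -VN.
Qed.

(** The supremum of the left endpoints lies in all the closed intervals, and [closed_cell_sub] puts
    it in the open ones. *)
Lemma cell_limit (u : nat -> seq bool) :
  (forall n, exists v w, u n.+1 = (u n ++ v) ++ true :: rcons w false) ->
  exists r, forall n, cell (u n) r.
Proof.
move=> h.
have mono m k : exists w, u (m + k)%N = u m ++ w.
  elim: k => [|k [w IH]]; first by exists [::]; rewrite addn0 cats0.
  by have [v' [w' uE]] := h (m + k)%N; rewrite addnS uE IH -!catA; eexists; reflexivity.
pose a n := (node (u n)).1; pose b n := (node (u n)).2.
have ab m n : a m <= b n.
  have lt k : a k < b k := node_lt (u k).
  have [mn|/ltnW nm] := leqP m n.
    have [w E] := mono m (n - m)%N; rewrite subnKC// in E.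
    have := lt n; rewrite /a /b E; have := node_le (u m) w; lra.
  have [w E] := mono n (m - n)%N; rewrite subnKC// in E.
  have := lt m; rewrite /a /b E; have := node_le (u n) w; lra.
exists (sup (range a)) => n; have [v [w uE]] := h n.
apply: (@cell_cat _ v); apply: (@closed_cell_sub _ w); rewrite -uE; apply/andP; split.
  apply: ub_le_sup; last by exists n.+1.
  by exists (b 0) => _ [m _ <-].
apply: ge_sup; first by exists (a 0), 0.
by move=> _ [m _ <-]; exact: ab.
Qed.

End bisection.

(** * Meager sets of reals and dense open sets of a countable preorder *)

Section cohen_walk.
Variable le : rel nat.
Hypotheses (le_refl : reflexive le) (le_trans : transitive le)
  (le0 : forall i, le i 0).
Implicit Types (D : set nat) (q : nat * nat) (s t u v w : seq bool).

Definition order_dense D := forall p, exists2 d, D d & le d p.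
Definition order_open D := forall d e, D d -> le e d -> D e.

(* The walk stands at [q.1]; [q.2] counts the zeros read since the last one,
   and names the point to which the next one tries to descend. *)
Definition wstep q (b : bool) : nat * nat :=
  if b then (if le q.2 q.1 then q.2 else q.1, 0) else (q.1, q.2.+1).

Definition walk := foldl wstep.

Lemma walk_le q v : le (walk q v).1 q.1.
Proof.
elim: v q => [|b v IH] q //=; apply: le_trans (IH _) _.
by rewrite /wstep; case: b => //=; case: ifP.
Qed.

(** This is how the walk is steered: with the counter at [0], [d] zeros and a one lead to any [d]
    below the current point. *)
Lemma walk_unary i n d : walk (i, n) (rcons (nseq d false) true) =
  (if le (n + d) i then n + d else i, 0).
Proof.
elim: d n => [|d IH] n /=; first by rewrite addn0.
by rewrite /= IH addSnnS.
Qed.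

(* Having entered [D], the walk is restarted or killed by the next bit. The
   restarts put below each node of the surviving tree a copy of all walks that
   avoid [D], the killing makes this tree nowhere dense. *)
Definition dstep D (o : option (nat * nat)) (b : bool) : option (nat * nat) :=
  if o is Some q then
    if `[< D q.1 >] then (if b then None else Some (0, 0)) else Some (wstep q b)
  else None.

Definition drun D := foldl (dstep D).

Lemma drun_cat D o s t : drun D o (s ++ t) = drun D (drun D o s) t.
Proof. exact: foldl_cat. Qed.

Lemma drun_None D v : drun D None v = None.
Proof. by elim: v. Qed.

(** The walk only descends, so by openness it cannot have entered [D] earlier. *)
Lemma drun_walk D q v : order_open D -> ~ D (walk q v).1 ->
  drun D (Some q) v = Some (walk q v).
Proof.
move=> oD; elim: v q => [|b v IH] q //= nD.
have -> : `[< D q.1 >] = false.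
  apply/asboolP => Dq; apply: nD; apply: oD Dq _.
  exact: (walk_le q (b :: v)).
exact: IH.
Qed.

(** The leading [true] resets the counter, after which a point of [D] can be named in unary; it is
    also the right turn that [cell_limit] asks for. *)
Lemma drun_reach D q : order_open D -> order_dense D -> ~ D q.1 ->
  exists w d, [/\ D d.1 & drun D (Some q) (true :: w) = Some d].
Proof.
move=> oD dD nD; pose q' := wstep q true.
have qE w : drun D (Some q) (true :: w) = drun D (Some q') w.
  by rewrite /drun /= asboolF.
have q'2 : q'.2 = 0 by [].
have [Dq'|nDq'] := pselect (D q'.1); first by exists [::], q'; rewrite qE.
have [d Dd dq'] := dD q'.1.
exists (rcons (nseq d false) true), (d, 0); split=> //; rewrite qE.
clearbody q'; clear qE; case: q' q'2 nDq' dq' => i n /= -> nDi di.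
have go k m : drun D (Some (i, m)) (nseq k false) = Some (i, m + k).
  elim: k m => [|k IH] m /=; first by rewrite addn0.
  by rewrite asboolF// IH/= addSnnS.
by rewrite -cats1 drun_cat go/= asboolF// /wstep/= add0n di.
Qed.

Section meager_code.
Variable R : realType.
Local Open Scope ring_scope.

Definition dead_free D : set R :=
  [set r | 0 < r < 1 /\ forall s, @cell R s r -> drun D (Some (0%N, 0%N)) s <> None].

(** Below any node where the run is alive it can be led into [D], and there a one kills it. *)
Lemma nowhere_dense_dead_free D : order_open D -> order_dense D ->
  nowhere_dense (dead_free D).
Proof.
move=> oD dD; apply/nowhere_denseP => U oU U0.
have [|nU] := pselect (U `&` @cell R [::] !=set0); last first.
  exists U; split=> //; apply/seteqP; split=> // r [Ur [r01 _]].
  by apply: nU; exists r; split.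
move=> /(cell_pi_base oU) [s sU].
have [v sv] : exists v, drun D (Some (0%N, 0%N)) (s ++ v) = None.
  case E : (drun D (Some (0%N, 0%N)) s) => [q|]; last first.
    by exists [::]; rewrite cats0.
  have [Dq|nDq] := pselect (D q.1).
    by exists [:: true]; rewrite drun_cat E/= asboolT.
  have [w [d [Dd wd]]] := drun_reach oD dD nDq.
  exists ((true :: w) ++ [:: true]).
  by rewrite !drun_cat E wd/= asboolT.
exists (@cell R (s ++ v)); split.
- exact: open_cell.
- exact: cell_neq0.
- by move=> r /cell_cat; exact: sU.
- by apply/seteqP; split=> // r [rsv [_ /(_ _ rsv)]]; rewrite sv.
Qed.

(** The walk reads [v] only, from its start, while the cell lies below [u]: [N] is seen through the
    copy of all walks placed at [u]. *)
Definition walk_targets (N : set R) u : set nat :=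
  [set (walk (0, 0)%N v).1 | v in [set v | @cell R (u ++ v) `&` N = set0]].

(** First name [p], which lies below the starting point [0], then extend the word to escape [N]. *)
Lemma walk_targets_dense N u : nowhere_dense N -> order_dense (walk_targets N u).
Proof.
move=> nN p; pose w := rcons (nseq p false) true.
have [v vN] := nowhere_dense_cell (u ++ w) nN.
exists (walk (0, 0)%N (w ++ v)).1; first by exists (w ++ v) => //=; rewrite catA.
rewrite /walk foldl_cat; apply: le_trans (walk_le _ _) _.
by rewrite -/(walk _ _) walk_unary le0.
Qed.

(** Otherwise each [N i] in turn can be escaped with the run still outside [D]; the run is then led
    into [D] and restarted. The limit is a point of [dead_free D] outside all [N i]. *)
Lemma dead_free_cover D (N : nat -> set R) : order_open D -> order_dense D ->
  dead_free D `<=` \bigcup_i N i -> exists i u, walk_targets (N i) u `<=` D.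
Proof.
move=> oD dD cov; apply: contrapT => no.
have ext i u : exists v w, @cell R (u ++ v) `&` N i = set0 /\
    drun D (Some (0, 0)%N) (v ++ true :: rcons w false) = Some (0, 0)%N.
  have [v [uv nDv]] : exists v, @cell R (u ++ v) `&` N i = set0 /\
      ~ D (walk (0, 0)%N v).1.
    apply: contrapT => nv; apply: no; exists i, u => _ [v uv <-].
    by apply: contrapT => nDv; apply: nv; exists v.
  have [w [d [Dd wd]]] := drun_reach oD dD nDv.
  exists v, w; split=> //; rewrite -cats1 -cat_cons !drun_cat.
  by rewrite drun_walk// wd/= asboolT.
pose V i u := sval (cid (ext i u)); pose W i u := sval (cid (svalP (cid (ext i u)))).
have VW i u : @cell R (u ++ V i u) `&` N i = set0 /\
    drun D (Some (0, 0)%N) (V i u ++ true :: rcons (W i u) false) = Some (0, 0)%N.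
  exact: (svalP (cid (svalP (cid (ext i u))))).
pose fix u n := if n is n'.+1 then
  (u n' ++ V n' (u n')) ++ true :: rcons (W n' (u n')) false else [::].
have [|r ur] := @cell_limit R u; first by move=> n; eexists; eexists; reflexivity.
have su n : (n <= size (u n))%N.
  elim: n => // n IH /=; rewrite !size_cat/= size_rcons; lia.
have du n : drun D (Some (0, 0)%N) (u n) = Some (0, 0)%N.
  elim: n => // n IH /=; rewrite -catA drun_cat IH.
  exact: (VW n (u n)).2.
have [|i _ Nr] := cov r.
  split; first by have := ur 0%N; rewrite /cell.
  (* A run killed at [s] would still be dead at [u (size s)], which extends [s]. *)
  move=> s rs; have [w uE] := cell_prefix (su (size s)) rs (ur _).
  have := du (size s); rewrite uE drun_cat.
  by move=> + s0; rewrite s0 drun_None.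
have : (@cell R (u i ++ V i (u i)) `&` N i) r.
  by split=> //; have /cell_cat := ur i.+1.
by rewrite (VW i (u i)).1.
Qed.

(** [Phi] is chosen before [D] is known: a code made of a member of [C], [i] and [u] selects
    targets, and a member of [C] covering [dead_free D] supplies a code that works for [D]. *)
Theorem cofinal_meager_refine (C : set (set R)) : cofinal_meager C ->
  exists Phi : (set_type C * (nat * seq bool))%type -> nat -> nat,
    (forall c p, le (Phi c p) p) /\
    forall D, order_open D -> order_dense D -> exists c, forall p, D (Phi c p).
Proof.
move=> [Cm Ccof].
have ext (c : set_type C) : exists N : nat -> set R,
    (forall n, nowhere_dense (N n)) /\ val c = \bigcup_n N n.
  by have [N nN cN] := Cm _ (set_mem (valP c)); exists N.
pose N c := sval (cid (ext c)).
have nN c n : nowhere_dense (N c n) by have [h _] := svalP (cid (ext c)); exact: h.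
have cN c : val c = \bigcup_n N c n by have [] := svalP (cid (ext c)).
have ex_phi (c : set_type C * (nat * seq bool)) p :
    exists k : nat, walk_targets (N c.1 c.2.1) c.2.2 k /\ le k p.
  by have [q ? ?] := walk_targets_dense c.2.2 (nN c.1 c.2.1) p; exists q.
exists (fun c p => sval (cid (ex_phi c p))); split=> [c p|D oD dD].
  by have [] := svalP (cid (ex_phi c p)).
have [|M CM DM] := Ccof (dead_free D).
  exists (fun=> dead_free D); first by move=> _; exact: nowhere_dense_dead_free.
  by apply/seteqP; split=> [r ?|r [_ _]]//; exists 0%N.
pose c : set_type C := SigSub (mem_set CM).
have [|i [u iuD]] := @dead_free_cover D (N c) oD dD; first by rewrite -cN.
exists (c, (i, u)) => p; apply: iuD.
by have [] := svalP (cid (ex_phi (c, (i, u)) p)).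
Qed.

End meager_code.
End cohen_walk.

(** * Topological preliminaries *)

Lemma xcard_le_trans (l k m : xcard) :
  (k <= l)%xcard -> (l <= m)%xcard -> (k <= m)%xcard.
Proof.
by case: k l m => [K|] [L|] [M|] //=; exact: card_le_trans.
Qed.

Lemma min_card_le (I : Type) (P : set I) (c : I -> xcard) j :
  P j -> (min_card P c <= c j)%xcard.
Proof.
by move=> Pj; have [|i -> [_ imin]] := @min_cardP I P c; [exists j|exact: imin].
Qed.

Lemma le_min_card (I : Type) (P : set I) (c : I -> xcard) k :
  (forall j, P j -> (k <= c j)%xcard) -> (k <= min_card P c)%xcard.
Proof.
move=> h; have [P0|/set0P P0] := eqVneq P set0.
  by rewrite P0 min_card0; case: k h.
by have [i -> [Pi _]] := min_cardP c P0; exact: h.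
Qed.

Section topology.
Variable T : topologicalType.
Implicit Types (x : T) (A N O : set T).

Lemma not_closureP A x : ~ closure A x <-> nbhs x (~` A).
Proof.
split=> [nA|nA cA]; last by have [y []] := cA _ nA.
apply: filterS (open_nbhs_nbhs (conj (closed_openC (@closed_closure _ A)) nA)).
by move=> y ny /subset_closure.
Qed.

Lemma meagerS A N : meager A -> N `<=` A -> meager N.
Proof.
move=> [F nF ->] NA; exists (fun n => F n `&` N).
  move=> n; apply/seteqP; split=> // x; rewrite -(nF n).
  by apply: interiorS; apply: closureS; exact: subIsetl.
apply/seteqP; split=> [x Nx|x [n _ []//]].
by have [n _ Fx] := NA _ Nx; exists n.
Qed.

Lemma nowhere_dense_meager N : nowhere_dense N -> meager N.
Proof.
by move=> nN; exists (fun=> N) => //; apply/seteqP; split=> [x ?|x []//]; exists 0.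
Qed.

Lemma meager0 : @meager T set0.
Proof. by apply: nowhere_dense_meager; rewrite /nowhere_dense closure0 interior0. Qed.

Lemma meagerU A N : meager A -> meager N -> meager (A `|` N).
Proof.
move=> [F nF ->] [G nG ->].
exists (fun n => if odd n then F n./2 else G n./2).
  by move=> n; case: odd.
apply/seteqP; split=> [x [[n _ Fx]|[n _ Gx]]|x [n _]].
- by exists n.*2.+1 => //=; rewrite odd_double/= uphalf_double.
- by exists n.*2 => //=; rewrite odd_double/= doubleK.
- by case: odd => ?; [left|right]; exists n./2.
Qed.

Lemma meager_bigcup_finite (C : set (set T)) : finite_set C ->
  (forall M, C M -> meager M) -> meager (\bigcup_(M in C) M).
Proof.
move=> /finite_seqP[s ->]; elim: s => [|M s IH] h.
  by apply: meagerS meager0 _ => x [A].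
have mM : meager M by apply: h; exact: mem_head.
have ms : meager (\bigcup_(A in [set` s]) A).
  by apply: IH => A As; apply: h; rewrite /= inE As orbT.
apply: meagerS (meagerU mM ms) _ => x [A /=]; rewrite inE => /predU1P[->|As] Ax.
  by left.
by right; exists A.
Qed.

Lemma nowhere_dense_closure N : nowhere_dense N -> nowhere_dense (closure N).
Proof.
by rewrite /nowhere_dense -(closure_id (closure N)).1//; exact: closed_closure.
Qed.

Lemma nowhere_dense_boundary O : open O -> nowhere_dense (closure O `\` O).
Proof.
move=> oO; apply/nowhere_denseP => V oV [x Vx].
have [[y [Vy Oy]]|VO] := pselect (V `&` O !=set0).
  exists (V `&` O); split; [exact: openI|by exists y|by move=> ? []|].
  by apply/seteqP; split=> // z [[_ ?] []].
exists V; split=> //; first by exists x.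
apply/seteqP; split=> // z [Vz [cz _]]; apply: VO.
by have [w []] := cz _ (open_nbhs_nbhs (conj oV Vz)); exists w.
Qed.

Lemma nbhs_forall_lt x (P : nat -> set T) n :
  (forall i, i < n -> nbhs x (P i)) -> nbhs x [set y | forall i, i < n -> P i y].
Proof.
elim: n => [|n IH] h; first by apply: filterS filterT => y _ i.
have hn := h _ (ltnSn n).
apply: filterS (filterI hn (IH (fun i lin => h i (ltnW lin)))) => y /= [Pn Pi] i.
by rewrite ltnS leq_eqVlt => /predU1P[->//|]; exact: Pi.
Qed.

Lemma compact_directed (G : set (set T)) : compact [set: T] -> G !=set0 ->
  (forall A, G A -> closed A /\ A !=set0) ->
  (forall A B, G A -> G B -> exists2 C, G C & C `<=` A `&` B) ->
  \bigcap_(A in G) A !=set0.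
Proof.
move=> cT G0 Gc Gd.
have FF : ProperFilter (filter_from G id).
  apply: filter_from_proper; last by move=> A /Gc[].
  exact: filter_from_filter.
have [|x [_ xF]] := cT _ FF; first by have [A GA] := G0; exists A.
exists x => A GA; apply: (Gc _ GA).1 => V Vx; apply: xF => //.
by exists A.
Qed.

Lemma compact_directed_sub (G : set (set T)) W : compact [set: T] -> G !=set0 ->
  (forall A, G A -> closed A) ->
  (forall A B, G A -> G B -> exists2 C, G C & C `<=` A `&` B) ->
  open W -> \bigcap_(A in G) A `<=` W -> exists2 A, G A & A `<=` W.
Proof.
move=> cT [A0 GA0] Gc Gd oW GW; apply: contrapT => no.
have [|||x xG] := @compact_directed [set A `&` ~` W | A in G] cT.
- by exists (A0 `&` ~` W); exists A0.
- move=> _ [A GA <-]; split.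
    by apply: closedI; [exact: Gc|exact: open_closedC].
  apply: contrapT => AW; apply: no; exists A => // x Ax; apply: contrapT => nWx.
  by apply: AW; exists x.
- move=> _ _ [A GA <-] [B GB <-]; have [D GD DAB] := Gd _ _ GA GB.
  exists (D `&` ~` W); first by exists D.
  by move=> x [/DAB [? ?] ?].
have [_] := xG _ (imageP (fun A => A `&` ~` W) GA0); apply.
by apply: GW => A GA; have [] := xG _ (imageP (fun A => A `&` ~` W) GA).
Qed.

End topology.

Lemma not_meagerT (R : realType) : ~ meager [set: R].
Proof.
move=> [N nN NT].
have /Baire : forall i, open (~` closure (N i)) /\ dense (~` closure (N i)).
  move=> i; split; first by apply: closed_openC; exact: closed_closure.
  move=> O O0 oO; have /nowhere_denseP /(_ _ oO O0) [V [oV [y Vy] VO VN]] := nN i.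
  exists y; split; first exact: VO.
  apply/not_closureP; apply: filterS (open_nbhs_nbhs (conj oV Vy)) => z Vz Nz.
  by have : (V `&` N i) z by []; rewrite VN.
have T0 : [set: R] !=set0 by exists 0%R.
move=> /(_ [set: R] T0 openT) [x [_ xN]].
have [i _ Nx] : (\bigcup_n N n) x by rewrite -NT.
by apply: (xN i) => //; exact: subset_closure.
Qed.

(** Singletons are meager, so a finite cofinal family would make the line a finite union of meager
    sets. *)
Lemma cofinal_meager_infinite (R : realType) (C : set (set R)) :
  cofinal_meager C -> infinite_set C.
Proof.
move=> [Cm Ccof] /meager_bigcup_finite /(_ Cm) mC; apply: (@not_meagerT R).
apply: meagerS mC _ => r _.
have [|M CM rM] := Ccof [set r]; last by exists M => //; exact: rM.
apply: nowhere_dense_meager; apply/nowhere_denseP => U oU U0.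
exists (U `\` [set r]); split.
- by apply: openI => //; apply: closed_openC;
  exact/accessible_closed_set1/hausdorff_accessible/Rhausdorff.
- have [y Uy] := U0; have [yr|/eqP yr] := eqVneq y r; last by exists y.
  have [e /= e0 eU] := open_nbhs_nbhs (conj oU Uy).
  exists (y + e / 2)%R; split; last by rewrite /= yr; lra.
  by apply: eU; rewrite /= opprD addNKr normrN gtr0_norm; lra.
- exact: subDsetl.
- by apply/seteqP; split=> // z [[_ nz] zr].
Qed.

(** * Metric spaces: normality, countable bases, locally finite open sequences *)

Section metric.
Variables (R : realType) (X : topologicalType) (d : X -> X -> R).
Local Open Scope ring_scope.
Hypotheses (d0 : forall x y, d x y = 0 <-> x = y)
  (dC : forall x y, d x y = d y x)
  (dD : forall x y z, d x z <= d x y + d y z)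
  (dN : forall x (A : set X), nbhs x A <->
          exists2 e : R, 0 < e & [set y | d x y < e] `<=` A).
Let mball x e : set X := [set y | d x y < e].

Let dxx x : d x x = 0. Proof. exact/d0. Qed.

Let open_mball x e : open (mball x e).
Proof.
rewrite openE => y /= xy; apply/dN; exists (e - d x y); first by rewrite subr_gt0.
move=> z /= yz; rewrite /mball/=; have := dD x y z; move: xy yz.
rewrite /mball/=; lra.
Qed.

Let closure_mball x e z : closure (mball x e) z -> d x z <= e.
Proof.
move=> cz; rewrite leNgt; apply/negP => ez.
have [|y [/= xy zy]] := cz (mball z (d x z - e)).
  by apply/dN; exists (d x z - e) => //; rewrite subr_gt0.
have := dD x y z; rewrite (dC y z); move: xy zy; rewrite /mball/=; lra.
Qed.

Let mball_in O x : open O -> O x -> exists2 e, 0 < e & mball x e `<=` O.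
Proof. by move=> oO Ox; apply/dN; exact: open_nbhs_nbhs. Qed.

Lemma metric_normal : normal_space X.
Proof.
apply/(@normal_openP R) => A B cA cB AB.
(* Doubling makes the two unions disjoint: if balls of radii [e] and [f] meet, doubling the larger
   one captures the other centre. *)
pose U (A B : set X) := \bigcup_(e in [set e | A e.1 /\ 0 < e.2 /\
    mball e.1 (e.2 *+ 2) `<=` ~` B]) mball e.1 e.2.
have oU A' B' : open (U A' B') by apply: bigcup_open => e _; exact: open_mball.
have AU A' B' : closed B' -> A' `&` B' = set0 -> A' `<=` U A' B'.
  move=> cB' AB' x Ax; have [||e e0 eB] := @mball_in (~` B') x.
  - exact: closed_openC.
  - by move=> Bx; have : (A' `&` B') x by []; rewrite AB'.
  exists (x, e / 2) => /=; last by rewrite /mball/= dxx; lra.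
  split=> //; split; first lra.
  by move=> z /= xz; apply: eB; move: xz; rewrite /mball/= mulr2n; lra.
exists (U A B), (U B A); split=> //; try exact: AU.
  by apply: AU => //; rewrite setIC.
apply/seteqP; split=> // z [[[a e]/= [Aa [e0 eB]] az] [[b f]/= [Bb [f0 fA]] bz]].
have h := dD a z b; have h' := dC z b; move: az bz; rewrite /mball/= => az bz.
have [ef|fe] := leP e f.
  apply: (fA a) => //; rewrite /mball/= mulr2n (dC b a); lra.
by apply: (eB b) => //; rewrite /mball/= mulr2n; lra.
Qed.

Lemma metric_base (D : set X) : countable D -> dense D -> [set: X] !=set0 ->
  exists B : nat -> set X, [/\ B 0%N = setT, forall n, open (B n),
    forall n, B n !=set0 & forall x O, open O -> O x ->
      exists n, B n x /\ closure (B n) `<=` O].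
Proof.
move=> cD dD' X0.
have [x0 [_ Dx0]] := dD' _ X0 openT.
have [e eD] : exists e : nat -> X, forall x, D x -> exists n, e n = x.
  have /countable_injP [f finj] := cD.
  pose g n : X := if pselect (exists2 x, D x & f x = n) is left h
    then sval (cid2 h) else x0.
  exists g => x Dx; exists (f x); rewrite /g; case: pselect => [h|]; last first.
    by case; exists x.
  by case: (cid2 h) => /= y Dy fxy; apply: finj => //; rewrite inE.
pose B' n := if unpickle n is Some (k, m) then mball (e k) (m.+1%:R^-1) else setT.
(* The numbering is shifted by one so that index [0] is free for the whole space, the top of the
   preorder of walks. *)
exists (fun n => if n is n'.+1 then B' n' else setT); split=> //.
- move=> [|n]; first exact: openT.
  by rewrite /B'; case: unpickle => [[k m]|]; [exact: open_mball|exact: openT].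
- move=> [|n]; first by exists x0.
  rewrite /B'; case: unpickle => [[k m]|]; last by exists x0.
  by exists (e k); rewrite /mball/= dxx invr_gt0.
move=> x O oO Ox; have [r r0 rO] := mball_in oO Ox.
have [m mr] : exists m : nat, m.+1%:R^-1 < r / 2.
  have r20 : 0 < r / 2 by lra.
  have /cvgrPdist_lt /(_ _ r20) [m _ /(_ m (leqnn m))] := @cvg_harmonic R.
  by rewrite /harmonic/= sub0r normrN gtr0_norm ?invr_gt0//; exists m.
have [|y [xy Dy]] := dD' _ _ (open_mball x m.+1%:R^-1).
  by exists x; rewrite /mball/= dxx invr_gt0.
have [k ky] := eD _ Dy.
exists (pickle (k, m)).+1; rewrite /B' pickleK ky; split.
  by rewrite /mball/= dC.
move=> z /closure_mball yz; apply: rO.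
have h := dD x y z; have h' : d x y < m.+1%:R^-1 := xy.
apply: (le_lt_trans h); move: (_^-1) yz h' mr => q; lra.
Qed.

(** The centres [x n] eventually leave each [W k] and the radii tend to [0], so a small ball about
    [y] meets only finitely many of the chosen balls. *)
Lemma metric_locally_finite (W : nat -> set X) (x : nat -> X) :
  (forall n, open (W n)) -> (forall m n, (m <= n)%N -> W m `<=` W n) ->
  (forall y, exists n, W n y) -> (forall n, ~ W n (x n)) ->
  exists U : nat -> set X, [/\ forall n, open (U n), forall n, U n !=set0
    & forall y : X, exists n, nbhs y [set z | forall m, (n <= m)%N -> ~ U m z]].
Proof.
move=> oW Wmono Wcov nWx; exists (fun n => mball (x n) n.+1%:R^-1); split.
- by move=> n; exact: open_mball.
- by move=> n; exists (x n); rewrite /mball/= dxx invr_gt0.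
move=> y; have [k Wy] := Wcov y; have [r r0 rW] := mball_in (oW k) Wy.
have r20 : 0 < r / 2 by lra.
have /cvgrPdist_lt /(_ _ r20) [m _ hm] := @cvg_harmonic R.
exists (maxn k m); apply/dN; exists (r / 2) => // z /= yz n.
rewrite geq_max => /andP[kn mn]; rewrite /mball/= => xz.
apply: (nWx n); apply: Wmono kn _ _; apply: rW; rewrite /mball/=.
have := hm n mn; rewrite /harmonic/= sub0r normrN gtr0_norm ?invr_gt0//.
have := dD y z (x n); rewrite (dC z (x n)).
by move: (_^-1) xz yz => q xz yz h hq; apply: (le_lt_trans h); lra.
Qed.

End metric.

(** Given a filter without cluster point, [W n] collects those of the first [n] basic sets that miss
    a member of it; the complement of [W n] stays in the filter, hence is non-empty. *)
Lemma non_compact_cover (X : topologicalType) (B : nat -> set X) :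
  (forall n, open (B n)) -> (forall x O, open O -> O x ->
      exists n, B n x /\ closure (B n) `<=` O) ->
  ~ compact [set: X] -> exists (W : nat -> set X) (x : nat -> X),
    [/\ forall n, open (W n), forall m n, (m <= n)%N -> W m `<=` W n,
      forall y, exists n, W n y & forall n, ~ W n (x n)].
Proof.
move=> oB bB /existsNP[F /not_implyP[FF /not_implyP[FT nF]]].
pose K k := exists2 A, F A & B k `&` A = set0.
pose W n := \bigcup_(k in [set k | (k < n)%N /\ K k]) B k.
have FW n : F (~` W n).
  elim: n => [|n IH]; first by apply: filterS filterT => y _ [k []].
  have [[A FA BA]|nK] := pselect (K n); last first.
    apply: filterS IH => y nW [k [kn Kk] By]; apply: nW; exists k => //; split=> //.
    by move: kn; rewrite ltnS leq_eqVlt => /predU1P[kn|//]; rewrite kn in Kk.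
  apply: filterS (filterI IH FA) => y [nW Ay] [k [kn Kk] By].
  move: kn; rewrite ltnS leq_eqVlt => /predU1P[kn|kn].
    have : (B n `&` A) y by rewrite -kn.
    by rewrite BA.
  by apply: nW; exists k.
pose x n := sval (cid (@filter_ex _ F FF _ (FW n))).
exists W, x; split.
- by move=> n; apply: bigcup_open => k _; exact: oB.
- by move=> m n mn y [k [km Kk] By]; exists k => //; split=> //; exact: leq_trans mn.
- move=> y; have : ~ cluster F y by move=> cy; apply: nF; exists y.
  move=> /existsNP[A /existsNP[V /not_implyP[FA /not_implyP[Vy AV]]]].
  move: Vy; rewrite nbhsE => -[V' [oV' V'y] V'V].
  have [k [By BV]] := bB _ _ oV' V'y; exists k.+1, k => //; split=> //.
  exists A => //; apply/seteqP; split=> // z [Bz Az]; apply: AV.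
  by exists z; split=> //; apply: V'V; apply: BV; exact: subset_closure.
- by move=> n; exact: (svalP (cid (@filter_ex _ F FF _ (FW n)))).
Qed.

(** * Closures in the compactification of subsets of [X] *)

Section beta_closures.
Variables (R : realType) (X : topologicalType).
Hypothesis mX : metrizable R X.
Local Notation j := (cs_in R X).
Implicit Types A P Q : set X.

Lemma cs_in_continuous : continuous j.
Proof.
by apply/continuousP => V oV; apply/(metrizable_embed mX).2; exists V.
Qed.

Lemma metrizable_normal : normal_space X.
Proof. by have [d [d0 dC dD dN]] := mX; exact: metric_normal dN. Qed.

Lemma beta_closure_closure A : closure (j @` closure A) = closure (j @` A).
Proof.
apply/seteqP; split; last by apply: closureS; apply: image_subset; exact: subset_closure.
rewrite [X in _ `<=` X](closure_id _).1; last exact: closed_closure.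
apply: closureS => _ [x Ax <-] V /cs_in_continuous /Ax [y [Ay Vy]].
by exists (j y); split=> //; exists y.
Qed.

(** A Urysohn function for [P] and [Q] extends to the compactification, and its extension separates
    the closures. *)
Lemma beta_disjoint P Q : closed P -> closed Q -> P `&` Q = set0 ->
  closure (j @` P) `&` closure (j @` Q) = set0.
Proof.
move=> cP cQ PQ.
have /(@uniform_separatorP _ R) [f [cf f01 f0 f1]] : uniform_separator P Q.
  exact: ((@normal_separatorP R _).1 metrizable_normal).
have [|g cg gf] := beta_extend cf.
  by move=> x; have := f01 _ (imageT f x); rewrite /= in_itv.
have gcl A c : (forall x, A x -> f x = c) -> closure (j @` A) `<=` g @^-1` [set c].
  move=> Ac; have /closure_id -> : closed (g @^-1` [set c]).
    by apply: closed_comp.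
  by apply: closureS => _ [x Ax <-]; rewrite /= gf; exact: Ac.
apply/seteqP; split=> // p [pP pQ].
have g0 : g p = 0%R by apply: gcl pP => x Px; apply: f0; exists x.
have g1 : g p = 1%R by apply: gcl pQ => x Qx; apply: f1; exists x.
by have := @oner_eq0 R; rewrite -g0 -g1 eqxx.
Qed.

Lemma beta_closure_setCl A : ~` closure (j @` ~` A) `<=` closure (j @` A).
Proof.
move=> p np; have : (closure (j @` A) `|` closure (j @` ~` A)) p.
  rewrite -closureU -image_setU setUv => V Vp.
  move: Vp; rewrite nbhsE => -[V' [oV' V'p] V'V].
  have [|q [V'q [x _ xq]]] := @beta_dense R X V' _ oV'; first by exists p.
  by exists q; split; [exists x|exact: V'V].
by case.
Qed.

End beta_closures.

(** * The upper bound *)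

Lemma seq_argmin (T : eqType) (h : T -> nat) (s : seq T) : s != [::] ->
  exists2 x, x \in s & forall y, y \in s -> h x <= h y.
Proof.
elim: s => // x [|x' s] IH _.
  by exists x; [exact: mem_head|move=> y; rewrite inE => /eqP->].
have [//|y ys ymin] := IH.
have [xy|yx] := leqP (h x) (h y).
  exists x; first exact: mem_head.
  by move=> z; rewrite inE => /predU1P[->//|/ymin]; exact: leq_trans.
exists y; first by rewrite inE ys orbT.
by move=> z; rewrite inE => /predU1P[->|/ymin//]; exact: ltnW.
Qed.

(** * Van Douwen's linked families *)

Section linked.
Variables (X : Type) (B U : nat -> set X) (p : nat -> nat).
Hypotheses (B0 : forall i, B i !=set0) (pU : forall n, B (p n) `<=` U n).
Implicit Types (f : nat -> nat) (s : seq (nat -> nat)).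

Definition refining f := forall i, B (f i) `<=` B i.

Fixpoint reach f n k : nat := if k is k'.+1 then
  maxn (reach f n k') (\max_(i < (reach f n k').+1) f i) else p n.

(* [reach f n k.+1] bounds the values of [f] at all indices within
   [reach f n k], which is what [spread_linked] needs. *)
Definition spread f n : set X :=
  \bigcup_(i in [set i | i <= reach f n n /\ B i `<=` U n]) B (f i).

Lemma reach_mono f n k l : k <= l -> reach f n k <= reach f n l.
Proof.
move=> /subnKC <-; elim: (l - k) => [|m IH]; first by rewrite addn0.
by rewrite addnS /=; apply: leq_trans IH _; exact: leq_maxl.
Qed.

Lemma reach_next f n k i : i <= reach f n k -> f i <= reach f n k.+1.
Proof.
move=> ik /=; apply: leq_trans (leq_maxr _ _).
have i' : i < (reach f n k).+1 by [].
exact: (leq_bigmax (Ordinal i')).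
Qed.

(* The functions of [s] are treated in the order of increasing reach: the cell
   picked for one of them is then within reach of all the remaining ones. *)
Lemma spread_linked n s : (size s <= n)%N ->
  (forall f, f \in s -> refining f) ->
  exists x, forall f, f \in s -> spread f n x.
Proof.
move=> sn rs.
(* [B c] is the last cell picked, [k] functions have been treated and [m] remain; [k + m <= n] keeps
   every stage within [reach f n n]. *)
suff gen m s' k c : size s' = m -> k + m <= n ->
    (forall f, f \in s' -> refining f /\ c <= reach f n k) -> B c `<=` U n ->
    exists2 x, B c x & forall f, f \in s' -> spread f n x.
  have [|||x _ xs] := gen _ s 0 (p n) erefl; last by exists x.
  - by rewrite add0n.
  - by move=> f fs; split=> //; exact: rs.
  - exact: pU.
elim: m s' k c => [|m IH] s' k c sm kn rc cU.
  have [x Bx] := B0 c; exists x => // f.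
  by move/size0nil : sm => ->.
have s0 : s' != [::] by apply: contra_eqN sm => /eqP->.
have [f fs fmin] := seq_argmin (fun f => reach f n k.+1) s0.
have [rf cf] := rc f fs.
have [||||x Bx xs] := IH (rem f s') k.+1 (f c).
- by rewrite size_rem// sm.
- by rewrite addSnnS.
- move=> g gs; have gs' := mem_rem gs; have [rg _] := rc _ gs'; split=> //.
  by apply: leq_trans (fmin _ gs'); exact: reach_next.
- by move=> x /rf; exact: cU.
exists x; first exact: rf.
move=> g; rewrite (perm_mem (perm_to_rem fs)) inE => /predU1P[->|]; last exact: xs.
exists c => //; split=> //; apply: leq_trans cf _; apply: reach_mono.
by apply: leq_trans kn; rewrite leq_addr.
Qed.

End linked.

(** * The remote set and its character *)

Section remote.
Variables (R : realType) (X : topologicalType) (mX : metrizable R X).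
Variables (B U : nat -> set X) (p : nat -> nat) (I : choiceType)
  (Phi : I -> nat -> nat).
Hypotheses (oB : forall n, open (B n)) (B0 : forall n, B n !=set0)
  (pU : forall n, B (p n) `<=` U n)
  (lfU : forall x : X, exists n, nbhs x [set z | forall m, n <= m -> ~ U m z])
  (rPhi : forall c, refining B (Phi c))
  (PhiP : forall N : set X, nowhere_dense N ->
     exists c, forall i, closure (B (Phi c i)) `&` N = set0)
  (i0 : I).
Local Notation j := (cs_in R X).
Implicit Types (c : I) (s : seq I).

(** The [n]-th spreads of [n] shrinkings have a common point; the union over [n] serves all finite
    numbers of shrinkings at once. *)
Let A c : set X := \bigcup_n spread B U p (Phi c) n.

Let oA c : open (A c).
Proof. by apply: bigcup_open => n _; apply: bigcup_open => i _; exact: oB. Qed.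

(** By local finiteness of [U], only finitely many cells [B (Phi c i)] of the union matter near a
    point. *)
Let closureA c (N : set X) : (forall i, closure (B (Phi c i)) `&` N = set0) ->
  closure (A c) `&` N = set0.
Proof.
move=> BN; apply/seteqP; split=> // x [+ Nx]; apply/not_closureP.
have [n nU] := lfU x.
have nB i : nbhs x (~` B (Phi c i)).
  apply/not_closureP => cx.
  by have : (closure (B (Phi c i)) `&` N) x by []; rewrite BN.
have := nbhs_forall_lt (n := \max_(m < n) (reach p (Phi c) m m).+1) (fun i _ => nB i).
move=> nB'; apply: filterS (filterI nU nB') => y [yU yB] [m _ [i [im iU] Bi]].
have [nm|mn] := leqP n m.
  by apply: (yU _ nm); apply: iU; exact: (@rPhi c).
apply: (yB i) => //; apply: leq_ltn_trans im _.
exact: (leq_bigmax (Ordinal mn)).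
Qed.

Let clA c := closure (j @` A c).
Let F : set (beta R X) := \bigcap_c clA c.

Let linked s : exists x, forall c, c \in s -> A c x.
Proof.
have [||x xs] := @spread_linked X B U p B0 pU (size s) (map Phi s).
- by rewrite size_map.
- by move=> f /mapP[c _ ->]; exact: rPhi.
by exists x => c cs; exists (size s) => //; apply: xs; exact: map_f.
Qed.

Let clAs s : set (beta R X) := \bigcap_(c in [set` s]) clA c.

Let clAsI (V W : set (beta R X)) : range clAs V -> range clAs W ->
  exists2 V', range clAs V' & V' `<=` V `&` W.
Proof.
move=> [s _ <-] [t _ <-]; exists (clAs (s ++ t)); first by exists (s ++ t).
move=> q qst; split=> c cs; apply: qst; rewrite /= mem_cat.
  by rewrite [_ \in _]cs.
by rewrite [X in _ || X]cs orbT.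
Qed.

Let clAs_closed V : range clAs V -> closed V.
Proof. by move=> [s _ <-]; apply: closed_bigI => c _; exact: closed_closure. Qed.

Let FE : F = \bigcap_(V in range clAs) V.
Proof.
apply/seteqP; split=> [q Fq _ [s _ <-] c _|q h c _]; first exact: Fq.
by apply: (h (clAs [:: c])); [exists [:: c]|rewrite /= mem_head].
Qed.

Let F_closed : closed F.
Proof. by apply: closed_bigI => c _; exact: closed_closure. Qed.

Let F_remote : remote_set F.
Proof.
split=> [|N nN].
  rewrite FE; apply: compact_directed; [exact: beta_compact| | |exact: clAsI].
    by exists (clAs [::]), [::].
  move=> V rV; split; first exact: clAs_closed.
  move: rV => [s _ <-]; have [x xs] := linked s.
  by exists (j x) => c cs; apply: subset_closure; exists x => //; exact: xs.
have [c cN] := PhiP (nowhere_dense_closure nN).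
apply/seteqP; split=> // q [Fq Nq].
have := beta_disjoint mX (@closed_closure _ _) (@closed_closure _ _) (closureA cN).
rewrite !beta_closure_closure// => <-; split=> //.
exact: Fq.
Qed.

Let ext c : set (beta R X) := ~` closure (j @` ~` A c).

Let open_ext c : open (ext c).
Proof. by apply: closed_openC; exact: closed_closure. Qed.

(* The boundary of [A c] is nowhere dense, so [F] lies in the closure of some
   [A c'] whose closure misses it. *)
Let F_ext c : F `<=` ext c.
Proof.
move=> q Fq cq; have [c' c'A] := PhiP (nowhere_dense_boundary (@oA c)).
have cA := closureA c'A.
have cn : closed (~` A c) by exact: open_closedC.
(* As the boundary is avoided, [P] lies in [A c] and [Q] misses [closure (A c)]; so [cq] rules out
   that [q] is adherent to [P], and [Fq] that it is adherent to [Q]. *)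
pose P := closure (A c') `&` closure (A c); pose Q := closure (A c') `&` ~` A c.
have : (closure (j @` P) `|` closure (j @` Q)) q.
  rewrite -closureU -image_setU -setIUr (_ : _ `|` _ = setT).
    by rewrite setIT beta_closure_closure//; exact: Fq.
  apply/seteqP; split=> // x _; have [Ax|nAx] := pselect (A c x); last by right.
  by left; exact: subset_closure.
case=> [Pq|Qq].
  have PA : P `&` ~` A c = set0.
    by rewrite -cA; apply/seteqP; split=> [x [[]]|x [? []]].
  have := beta_disjoint mX _ cn PA.
  by rewrite -subset0 => /(_ (closedI (@closed_closure _ _) (@closed_closure _ _)) q); apply.
have QA : Q `&` closure (A c) = set0.
  by rewrite -cA; apply/seteqP; split=> [x [[]]|x [? []]].
have := beta_disjoint mX _ (@closed_closure _ _) QA.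
rewrite -subset0 => /(_ (closedI (@closed_closure _ _) cn) q); apply.
by split=> //; rewrite beta_closure_closure//; exact: Fq.
Qed.

(** By compactness some finite intersection [clAs s] lies in a given neighborhood of [F], and
    [exts s] is an open set between [F] and [clAs s]. *)
Lemma chi_R_le : (chi_R R X <= Some (seq I))%xcard.
Proof.
apply: (xcard_le_trans (l := character F)).
  exact: (@min_card_le _ [set F | closed F /\ remote_set F] _ F).
pose exts s : set (beta R X) := \bigcap_(c in [set` s]) ext c.
apply: (xcard_le_trans (l := Some (set_type (range exts)))).
  apply: (@min_card_le _ _ (fun V => Some (set_type V))); split.
    move=> _ [s _ <-]; split; last by move=> q Fq c _; exact: F_ext.
    elim: s => [|c s IH]; first by rewrite (_ : exts _ = setT)//; [exact: openT|exact/seteqP].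
    rewrite (_ : exts _ = ext c `&` exts s); first exact: openI.
    apply/seteqP; split=> [q h|q [qc qs] c'].
      split=> [|c' cs']; apply: h; first exact: mem_head.
      by rewrite /= inE [X in _ || X]cs' orbT.
    by rewrite /= inE => /predU1P[->//|]; exact: qs.
  move=> W oW; rewrite FE => /compact_directed_sub.
  move=> /(_ (@beta_compact _ _) _ clAs_closed clAsI oW) [|_ [s _ <-] sW].
    by exists (clAs [::]), [::].
  exists (exts s); first by exists s.
  move=> q qs; apply: sW => c cs; apply: beta_closure_setCl.
  exact: qs.
by rewrite /= (card_le_eql (card_setT _)); exact: card_image_le.
Qed.

End remote.

(** * The lower bound *)

Lemma closed_discrete_locally_finite (X : topologicalType) (D : set X) :
  accessible_space X ->
  (forall x : X, exists2 V, nbhs x V & finite_set (V `&` D)) -> closed_discrete D.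
Proof.
move=> aX lfD.
have sep (x : X) : exists2 V, nbhs x V & V `&` D `<=` [set x].
  have [V Vx finV] := lfD x.
  have cl : closed ((V `&` D) `\` [set x]).
    by apply: (accessible_finite_set_closed.1 aX); exact: finite_setD.
  exists (V `&` ~` ((V `&` D) `\` [set x])).
    apply: filterI => //; apply: open_nbhs_nbhs; split; first exact: closed_openC.
    by move=> [_]; apply.
  move=> y [[Vy ny] Dy]; apply: contrapT => yx; exact: ny.
split.
  move=> x cx; have [V Vx VD] := sep x.
  by have [y [Dy Vy]] := cx _ Vx; rewrite -(VD y).
apply/seteqP; split=> [x|x Dx]; first exact: isolatedS.
split; first exact/mem_set.
have [V Vx VD] := sep x; exists V => //; apply/seteqP; split=> // _ ->.
by split=> //; exact: nbhs_singleton.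
Qed.

Section far.
Variables (R : realType) (X : topologicalType) (mX : metrizable R X).
Variables (B : nat -> set X).
Hypotheses (oB : forall n, open (B n))
  (bB : forall x O, open O -> O x -> exists n, B n x /\ closure (B n) `<=` O).
Variables (F : set (beta R X)) (UU : set (set (beta R X))).
Hypotheses (cF : closed F) (farF : far_set F) (baseF : nbhd_base F UU) (x0 : X).
Local Notation j := (cs_in R X).

Let base x O : open O -> O x -> exists n, B n x /\ B n `<=` O.
Proof.
move=> oG /(bB oG) [n [Bx BO]]; exists n; split=> // y By; apply: BO.
exact: subset_closure.
Qed.

Let accX : accessible_space X.
Proof.
move=> x y xy.
have jxy : j x != j y by apply: contra_neq xy; exact: (metrizable_embed mX).1.
have [V [oV xV yV]] := hausdorff_accessible (@beta_hausdorff R X) jxy.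
exists (j @^-1` V); split; first by apply/(metrizable_embed mX).2; exists V.
  by rewrite inE; exact: set_mem xV.
by rewrite inE; exact: set_mem yV.
Qed.

Let K k := closure (j @` B k) `&` F = set0.

(** [F] misses the image of [X] because singletons are closed discrete; regularity of the
    compactification does the rest. *)
Let K_cover x : exists2 k, K k & B k x.
Proof.
have nFx : (~` F) (j x).
  move=> Fx; have : closed_discrete [set x].
    by apply: closed_discrete_locally_finite => // y; exists setT => //;
      [exact: filterT|rewrite setTI; exact: finite_set1].
  move=> /(farF.2); rewrite -subset0 => /(_ (j x)); apply; split=> //.
  by apply: subset_closure; exists x.
have rb : regular_space (beta R X).
  by move=> q; apply: (compact_regular (@beta_hausdorff R X) (@beta_compact R X) filterT).
have [V Vx VF] := rb _ _ (open_nbhs_nbhs (conj (closed_openC cF) nFx)).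
have := cs_in_continuous mX Vx; rewrite nbhsE => -[G [oG Gx] GV].
have [k [Bx BO]] := base oG Gx.
exists k => //; apply/seteqP; split=> // q [cq Fq]; apply: (VF q) => //.
by move: q cq {Fq}; apply: closureS => _ [y By <-]; apply: GV; exact: BO.
Qed.

(** The countable cover by the [B k] with [K k], made disjoint. *)
Let S n : set X := [set x | [/\ K n, B n x & forall k, k < n -> K k -> ~ B k x]].

Let S_cover x : exists n, S n x.
Proof.
have [k0 Kk0 Bk0] := K_cover x.
have ex : exists k, `[< K k /\ B k x >] by exists k0; apply/asboolP.
case: (ex_minnP ex) => n /asboolP [Kn Bn] nmin; exists n; split=> // k kn Kk Bk.
have : (n <= k)%N by apply: nmin; apply/asboolP.
by rewrite leqNgt kn.
Qed.

(* When [B i] misses [S n], this is the junk value [x0]. *)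
Let pt n i := xget x0 (B i `&` S n).

Let ptP n i : B i `&` S n !=set0 -> (B i `&` S n) (pt n i).
Proof. by move=> [x]; exact: xgetI. Qed.

Let D f : set X :=
  [set x | exists n i, [/\ i <= f n, (B i `&` S n) x & x = pt n i]].

(** In each layer [f] admits finitely many points, and a [B k] with [K k] meets only the layers up
    to [k]. *)
Let D_closed_discrete f : closed_discrete (D f).
Proof.
apply: closed_discrete_locally_finite => // x; have [k Kk Bx] := K_cover x.
exists (B k); first exact: open_nbhs_nbhs.
pose s := [seq pt n i | n <- iota 0 k.+1, i <- iota 0 (f n).+1].
apply: (@sub_finite_set _ _ [set` s]); last exact: finite_seq.
move=> y [By [n [i [ifn [_ Sn] xE]]]]; rewrite xE in By Sn; rewrite xE.
have nk : n <= k by rewrite leqNgt; apply/negP => kn; have [_ _ /(_ k kn Kk)] := Sn.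
by apply/allpairsPdep; exists n, i; rewrite !mem_iota !add0n !ltnS.
Qed.

Let hits (V : set (beta R X)) m (y : nat * nat) :=
  m <= y.1 /\ (B y.2 `&` S y.1) (pt y.1 y.2) /\ V (j (pt y.1 y.2)).

(** Near a point of [F] the first [m] layers are absent, so [V] contains a point of a later layer,
    together with a basic set around it. *)
Let hits_ex V m : UU V -> exists y, hits V m y.
Proof.
move=> UV; have [oV FV] := baseF.1 _ UV; apply: contrapT => no.
have [q Fq] := farF.1.
have near k : k < m -> nbhs q [set r | K k -> ~ (j @` B k) r].
  move=> _; have [Kk|nK] := pselect (K k); last by apply: filterS filterT => r _ /nK.
  have : nbhs q (~` (j @` B k)).
    apply/not_closureP => cq.
    by have : (closure (j @` B k) `&` F) q by []; rewrite Kk.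
  by apply: filterS => r nr _.
have : nbhs q (V `&` [set r | forall k, k < m -> K k -> ~ (j @` B k) r]).
  by apply: filterI (nbhs_forall_lt near); apply: open_nbhs_nbhs; split=> //; exact: FV.
rewrite nbhsE => -[G [oG Gq] GV].
have [|q' [Gx [x _ xq]]] := @beta_dense R X G _ oG; first by exists q.
rewrite -{}xq in Gx.
have [Vx nx] := GV _ Gx.
have [n Sx] := S_cover x.
have oVX : open (j @^-1` V) by apply/(metrizable_embed mX).2; exists V.
have [i [Bx BV]] := base oVX Vx.
have P : (B i `&` S n) (pt n i) by apply: ptP; exists x.
have nm : n < m.
  rewrite ltnNge; apply/negP => mn; apply: no; exists (n, i); split=> //; split=> //.
  by apply: BV; case: P.
by have [Kn Bn _] := Sx; apply: (nx n nm Kn); exists x.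
Qed.

Let h V m := (xget (0, 0) (hits V m)).2.

Let hP V m : UU V -> hits V m (xget (0, 0) (hits V m)).
Proof. by move=> /(hits_ex m) [y]; exact: xgetI. Qed.

(** If [V] misses the closure of [D f'], every hit in [V] has an index above the value of [f'] at
    its layer; so the functions [h V] dominate. *)
Lemma dominating_number_le : (dominating_number <= Some (set_type UU))%xcard.
Proof.
apply: (xcard_le_trans (l := Some (set_type (h @` UU)))); last first.
  rewrite /= (card_le_eql (card_setT _)) (card_le_eqr (card_setT _)).
  exact: card_image_le.
apply: (@min_card_le _ _ (fun V => Some (set_type V))) => f.
(* The hit recorded for [m] may lie in a layer beyond [m], so [f] is first made monotone. *)
pose f' n := \max_(i < n.+1) f i.
have ff' m n : (m <= n)%N -> (f m <= f' n)%N.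
  by rewrite -ltnS => mn; exact: (leq_bigmax (Ordinal mn)).
have [V UV VD] : exists2 V, UU V & V `<=` ~` closure (j @` D f').
  apply: baseF.2; first by apply: closed_openC; exact: closed_closure.
  move=> q Fq cq; have := farF.2 _ (D_closed_discrete f').
  by rewrite -subset0 => /(_ q); apply.
exists (h V); first by exists V.
rewrite (_ : [set n | _] = set0); first exact: finite_set0.
apply/seteqP; split=> // m /= hf; have [mn [P Vp]] := hP m UV.
apply: (VD _ Vp); apply: subset_closure; eexists; last reflexivity.
eexists; eexists; split; last reflexivity; last exact: P.
by apply: leq_trans (ltnW hf) (ff' _ _ mn).
Qed.

End far.

(** An interior point of [D] would be isolated in [X]. *)
Lemma crowded_closed_discrete_nowhere_dense (X : topologicalType) (D : set X) :
  crowded X -> closed_discrete D -> nowhere_dense D.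
Proof.
move=> crX [cD iD]; rewrite /nowhere_dense -(closure_id D).1//.
apply/seteqP; split=> // x Dx.
have : D x by exact: interior_subset.
rewrite -iD => -[_ [V Vx VD]].
have : isolated [set: X] x.
  split; first exact: mem_set.
  exists (V `&` D); first exact: filterI.
  by rewrite setIT.
by rewrite crX.
Qed.

Unset Implicit Arguments.
Set Strict Implicit.

(* Crowdedness of X is required in the middle inequality only: if X has an
   isolated point p, then {p} is a clopen remote set, so chi_R X = 1. *)
Theorem theorem3p3 (R : realType) (X : topologicalType)
    (metX : metrizable R X) (sepX : separable X)
    (ncptX : ~ compact [set: X]) :
  [/\ (dominating_number <= chi_F R X)%xcard,
      (crowded X -> (chi_F R X <= chi_R R X)%xcard)
    & (chi_R R X <= cof_meager R)%xcard].
Proof.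
have [d [d0 dC dD dN]] := metX.
have X0 : [set: X] !=set0.
  apply/set0P/eqP => XE; apply: ncptX; rewrite XE; exact: compact0.
have [D0 cD0 dD0] := sepX.
have [B [B0 oB Bn0 bB]] := metric_base d0 dC dD dN cD0 dD0 X0.
have [x0 _] := X0.
split.
- apply: le_min_card => F [cF farF]; apply: le_min_card => U baseU.
  exact: (dominating_number_le metX oB bB cF farF baseU x0).
- move=> crX; apply: le_min_card => F [cF [F0 rF]].
  apply: (@min_card_le _ [set F | closed F /\ far_set F] _ F); split=> //.
  split=> // D cdD; apply: rF.
  exact: crowded_closed_discrete_nowhere_dense.
have [W [x [oW Wmono Wcov nWx]]] := non_compact_cover oB bB ncptX.
have [U [oU U0 lfU]] := metric_locally_finite d0 dC dD dN oW Wmono Wcov nWx.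
have /choice[p pU] n : exists k, B k `<=` U n.
  have [y Uy] := U0 n; have [k [_ BU]] := bB _ _ (oU n) Uy.
  by exists k => z Bz; apply: BU; exact: subset_closure.
apply: le_min_card => C cofC.
(* The walks run in the base preordered by inclusion, with [B 0] on top. *)
pose le i k := `[< B i `<=` B k >].
have le_refl : reflexive le by move=> i; apply/asboolP.
have le_trans : transitive le.
  by move=> i k l /asboolP ki /asboolP il; apply/asboolP; exact: subset_trans il.
have le0 i : le i 0 by apply/asboolP; rewrite B0.
have [Phi [Phi_le PhiP]] := cofinal_meager_refine le_refl le_trans le0 cofC.
have iC : infinite_set [set: set_type C].
  by rewrite (eq_finite_set (card_setT C)); exact: cofinal_meager_infinite cofC.
pose I : choiceType := (set_type C * (nat * seq bool))%type.
have avoid (N : set X) : nowhere_dense N ->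
    exists c : I, forall i, closure (B (Phi c i)) `&` N = set0.
  move=> /nowhere_denseP nN.
  (* The base sets whose closure misses [N] form an open set of the preorder, dense because [N] is
     nowhere dense. *)
  apply: (PhiP [set k | closure (B k) `&` N = set0]) => [k l /= kN /asboolP lk|k].
    by rewrite -subset0 -kN; apply: setSI; exact: closureS.
  have [V [oV [y Vy] Vk VN]] := nN _ (oB k) (Bn0 k).
  have [l [_ lV]] := bB _ _ oV Vy; exists l.
    by rewrite /= -subset0 -VN; exact: setSI.
  by apply/asboolP => z Bz; apply: Vk; apply: lV; exact: subset_closure.
have [i0 _] : [set: I] !=set0.
  have [c _] := infinite_setN0 iC.
  by exists (c, (0, [::])).
apply: (xcard_le_trans (l := Some (seq I))).
  apply: (chi_R_le metX oB Bn0 pU lfU _ avoid) => c i x' Bx.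
  by have /asboolP := Phi_le c i; exact.
(* It remains to count: [C] is infinite, so it absorbs the countable factor of [I] and the passage
   to finite sequences. *)
have nC : ([set: (nat * seq bool)%type] #<= [set: set_type C])%card.
  by apply: (@card_le_trans _ _ _ [set: nat]); [exact: countableP|exact/infiniteP].
have /card_le_injP[f finj] := card_prod_le iC nC.
apply: (@card_le_trans _ _ _ [set: seq (set_type C)]); last exact: card_seq_le.
by apply/card_le_injP; exists (map f); exact: inj_map.
Qed.
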